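(* Let $n \geq 3$, let $G = C_{n,n}$ be the $n$-crown graph on vertex set $\{x_1,\ldots,x_n,y_1,\ldots,y_n\}$, and let $J(G) \subset S = \mathbb{K}[x_1,\ldots,x_n,y_1,\ldots,y_n]$ be its cover ideal, where $\mathbb{K}$ is a field. Then for all $s \geq 1$, $$\operatorname{reg}(J(G)^s) = s \cdot \deg(J(G)).$$
   Context: The crown graph $C_{n,n}$ is the bipartite graph on $\{x_1,\ldots,x_n,y_1,\ldots,y_n\}$ with edge set $\{\{x_i,y_j\} : 1 \leq i,j \leq n,\ i \neq j\}$. Vertices of a graph are identified with the variables of the standard graded polynomial ring $S$. The cover ideal of a graph $G$ is $J(G) = \left(\prod_{x \in w} x \mid w \text{ a minimal vertex cover of } G\right) \subset S$; equivalently $J(G) = \bigcap_{\{u,v\} \in E(G)} (u,v)$. Here $\deg(J(G)) = \max\{|C| : C \text{ is a minimal vertex cover of } G\}$. For a finitely generated graded $S$-module $N$, $\operatorname{reg}(N) = \max\{j - i \mid \operatorname{Tor}_i^S(N,\mathbb{K})_j \neq 0\}$; $\operatorname{reg}(J(G)^s)$ is the regularity of the ideal $J(G)^s$ viewed as an $S$-module. *)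

(* Defs.v *)
From HB Require Import structures.
From mathcomp Require Import all_boot all_order all_algebra.
From mathcomp Require Import mpoly.

Set Implicit Arguments.
Unset Strict Implicit.
Unset Printing Implicit Defensive.

Import Order.TTheory GRing.Theory Num.Theory.
Local Open Scope ring_scope.

Section Ideals.
Variable R : comNzRingType.

Definition ideal_gen (A : R -> Prop) (p : R) : Prop :=
  exists k (c g : 'I_k -> R),
    (forall i, A (g i)) /\ p = \sum_(i < k) c i * g i.

Definition ideal_pow (I : R -> Prop) (s : nat) : R -> Prop :=
  ideal_gen (fun p => exists g : 'I_s -> R,
    (forall i, I (g i)) /\ p = \prod_(i < s) g i).

End Ideals.

Section CoverIdeal.
Variable m : nat.
Implicit Types (e : rel 'I_m) (C : {set 'I_m}).

Definition vertex_cover e C : bool :=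
  [forall u, forall v, e u v ==> (u \in C) || (v \in C)].

Definition minimal_vertex_cover e C : bool := minset (vertex_cover e) C.

Definition cover_ideal (K : fieldType) e : {mpoly K[m]} -> Prop :=
  ideal_gen (fun p => exists2 C, minimal_vertex_cover e C
                               & p = \prod_(u in C) 'X_u).

Definition cover_degree e : nat :=
  \max_(C : {set 'I_m} | minimal_vertex_cover e C) #|C|.

End CoverIdeal.

Arguments cover_ideal {m} K e _.

(* The vertex x_i is [lshift n i] and the vertex y_j is [rshift n j]. *)
Definition crown (n : nat) : rel 'I_(n + n) := fun u v =>
  match split u, split v with
  | inl i, inr j | inr i, inl j => i != j
  | _, _ => false
  end.
Arguments crown n _ _ : clear implicits.

Section Regularity.
Variables (K : fieldType) (m : nat).
Local Notation S := {mpoly K[m]}.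

(* The zero polynomial is homogeneous of every degree, negative ones included. *)
Definition homog_of_degree (d : int) (p : S) : Prop :=
  {in msupp p, forall mm, (mdeg mm)%:Z = d}.

(* F_i is the graded free module \bigoplus_k S(- gshift i k), whose k-th basis
   vector has degree [gshift i k]. Its elements are row vectors, on which the
   differential F_(i+1) -> F_i and the augmentation F_0 -> S act by right
   multiplication. *)
Record free_complex := FreeComplex {
  grank : nat -> nat;
  gshift : forall i, 'I_(grank i) -> int;
  gdiff : forall i, 'M[S]_(grank i.+1, grank i);
  gaug : 'cV[S]_(grank 0)
}.

Definition graded_free_resolution (I : S -> Prop) (F : free_complex) : Prop :=
  [/\ forall i a b,
        homog_of_degree (@gshift F i.+1 a - @gshift F i b) (gdiff F i a b),
      forall a, homog_of_degree (@gshift F 0 a) (gaug F a 0),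
      forall p, I p <-> exists v : 'rV_(grank F 0), p = (v *m gaug F) 0 0,
      forall v : 'rV_(grank F 0),
        v *m gaug F = 0 <-> exists w, v = w *m gdiff F 0
    & forall i (v : 'rV_(grank F i.+1)),
        v *m gdiff F i = 0 <-> exists w, v = w *m gdiff F i.+1].

(* The differential of F \otimes_S K, where K = S / (X_0, ..., X_(m-1)). *)
Definition tensor_diff (F : free_complex) i :
    'M[K]_(grank F i.+1, grank F i) :=
  map_mx (mcoeff 0%MM) (gdiff F i).

(* The row space of this matrix is the degree j part of F_i \otimes_S K. *)
Definition tensor_degree (F : free_complex) i (j : int) : 'M[K]_(grank F i) :=
  diag_mx (\row_k (@gshift F i k == j)%:R).

Definition tensor_cycles (F : free_complex) i : 'M[K]_(grank F i) :=
  match i with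
  | 0 => 1%:M
  | i'.+1 => kermx (tensor_diff F i')
  end.

(* H_i(F \otimes_S K)_j != 0. When F is a graded free resolution of N, this
   homology space is Tor_i^S(N, K)_j. *)
Definition tor_neq0 (F : free_complex) (i : nat) (j : int) : bool :=
  ~~ (tensor_cycles F i :&: tensor_degree F i j
        <= tensor_degree F i.+1 j *m tensor_diff F i)%MS.

(* reg(I) = r. Since Tor does not depend on the resolution, the maximum is
   required to be r for every resolution; the first conjunct keeps the second
   from holding vacuously. *)
Definition regularity_is (I : S -> Prop) (r : int) : Prop :=
  (exists F, graded_free_resolution I F) /\
  forall F, graded_free_resolution I F ->
    (exists i j, tor_neq0 F i j /\ j - i%:Z = r) /\
    (forall i j, tor_neq0 F i j -> j - i%:Z <= r).

End Regularity.

(* Main.v *)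
(* Let X and Y be the products of all the x_j and of all the y_j.  The minimal
   vertex covers give J = (X, Y, M_1, ..., M_n) with M_i = XY / (x_i y_i), and XY
   divides M_i M_j for i <> j, so J^s is generated by the X^a Y^b M_i^c with
   a + b + c = s.  Since M_i^s is a minimal generator of the top degree
   r = s(2n - 2), it remains to prove reg J^s <= r.

   If I and (I : u) are resolved, the mapping cone of a comparison map lifting
   multiplication by u resolves I + (u); hence
   reg (I + (u)) <= max (reg I, deg u, reg (I : u) + deg u - 1).
   For s >= 2 the generators are adjoined by increasing c, then b: the colon ideals
   are (x_i, y_i) when c > 0 and (X) when c = 0.  For s = 1 the order X, M_i, Y has
   colon ideals (x_i) and (X / x_1, ..., X / x_n).

   Any two resolutions of an ideal are homotopy equivalent by graded maps, so the
   shifts of the one constructed bound Tor computed from any other. *)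

Require Import Defs.
From mathcomp Require Import all_boot all_order all_algebra.
From mathcomp Require Import mpoly.
From mathcomp Require Import zify.
From Stdlib Require Import ClassicalEpsilon.

Set Implicit Arguments.
Unset Strict Implicit.
Unset Printing Implicit Defensive.

Import Order.TTheory GRing.Theory Num.Theory.

(** Comparison maps and homotopies are built one homological position at a time, each matrix having
    its own dimensions; hence choice over a family of types, with an invariant [P] that permits the
    next step. *)
Lemma dependent_choice_nat (T : nat -> Type) (P : forall i, T i -> Prop)
    (Q : forall i, T i -> T i.+1 -> Prop) (t0 : T 0) :
    P 0 t0 ->
    (forall i t, P i t -> exists t', P i.+1 t' /\ Q i t t') ->
  exists f : forall i, T i,
    f 0 = t0 /\ forall i, P i (f i) /\ Q i (f i) (f i.+1).
Proof.
move=> P0 step.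
pose nxt i (t : {t : T i | P i t}) : {t' : T i.+1 | P i.+1 t'} :=
  let s := constructive_indefinite_description _ (step i _ (proj2_sig t)) in
  exist _ (proj1_sig s) (proj1 (proj2_sig s)).
have nxtQ i t : Q i (proj1_sig t) (proj1_sig (@nxt i t)).
  by rewrite /nxt; case: constructive_indefinite_description => ? [].
pose fix f i : {t : T i | P i t} :=
  if i is i'.+1 then nxt i' (f i') else exist _ t0 P0.
exists (fun i => proj1_sig (f i)); split=> // i.
by split; [exact: (proj2_sig (f i)) | exact: nxtQ].
Qed.

(** * Homogeneous components *)

Section HomogeneousComponents.
Local Open Scope ring_scope.
Variables (K : fieldType) (m : nat).
Local Notation S := {mpoly K[m]}.
Implicit Types (p q : S) (d e : int) (P : pred 'X_{1..m}).

Definition mfilter P p : S := \sum_(k <- msupp p | P k) p@_k *: 'X_[k].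

Lemma mcoeff_mfilter P p k : (mfilter P p)@_k = if P k then p@_k else 0.
Proof.
rewrite /mfilter raddf_sum /=.
under eq_bigr => k' _ do rewrite mcoeffZ mcoeffX.
have [kp | kNp] := boolP (k \in msupp p).
  rewrite big_mkcond (bigD1_seq k) //= eqxx mulr1 big1 ?addr0 // => k' /negPf->.
  by case: (P k') => //; rewrite mulr0.
rewrite (memN_msupp_eq0 kNp) if_same big_seq_cond big1 // => k' /andP[k'p _].
by case: eqP kNp => [<- | _]; rewrite ?k'p ?mulr0.
Qed.

Lemma mfilterD P p q : mfilter P (p + q) = mfilter P p + mfilter P q.
Proof.
apply/mpolyP=> k; rewrite mcoeffD !mcoeff_mfilter mcoeffD.
by case: (P k); rewrite ?addr0.
Qed.

Lemma mfilter_sum (I : finType) P (f : I -> S) :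
  mfilter P (\sum_i f i) = \sum_i mfilter P (f i).
Proof.
apply/mpolyP=> k; rewrite mcoeff_mfilter !raddf_sum /=.
under [RHS]eq_bigr => i _ do rewrite mcoeff_mfilter.
by case: (P k) => //; rewrite big1.
Qed.

Lemma homog_of_degreeE d p :
  homog_of_degree d p <-> forall k, p@_k != 0 -> (mdeg k)%:Z = d.
Proof.
by split=> H k; [rewrite -mcoeff_msupp | rewrite mcoeff_msupp]; exact: H.
Qed.

Lemma homog0 d : homog_of_degree d (0 : S).
Proof. by apply/homog_of_degreeE=> k; rewrite mcoeff0 eqxx. Qed.

Lemma homogX k : homog_of_degree (mdeg k)%:Z ('X_[k] : S).
Proof. by move=> k'; rewrite msuppX inE => /eqP->. Qed.

Lemma homog1 : homog_of_degree 0 (1 : S).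
Proof. by rewrite -mpolyX0; have := @homogX 0%MM; rewrite mdeg0. Qed.

Lemma homogD d p q :
  homog_of_degree d p -> homog_of_degree d q -> homog_of_degree d (p + q).
Proof. by move=> hp hq k /msuppD_le; rewrite mem_cat => /orP[/hp | /hq]. Qed.

Lemma homogN d p : homog_of_degree d p -> homog_of_degree d (- p).
Proof. by move=> hp k; rewrite (perm_mem (msuppN p)) => /hp. Qed.

Lemma homogM d e p q :
  homog_of_degree d p -> homog_of_degree e q -> homog_of_degree (d + e) (p * q).
Proof.
move=> hp hq k /msuppM_le /allpairsP[[k1 k2] /= [/hp <- /hq <- ->]].
by rewrite mdegD PoszD.
Qed.

Lemma homog_sum (I : finType) d (f : I -> S) :
  (forall i, homog_of_degree d (f i)) -> homog_of_degree d (\sum_i f i).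
Proof.
move=> hf; elim/big_ind: _ => //; [exact: homog0 | exact: homogD].
Qed.

Definition hcomp d := mfilter (fun k => (mdeg k)%:Z == d).

Lemma hcomp_homog d p : homog_of_degree d (hcomp d p).
Proof.
apply/homog_of_degreeE=> k; rewrite mcoeff_mfilter.
by case: (eqVneq (Posz (mdeg k)) d) => //= _; rewrite eqxx.
Qed.

Lemma hcomp_id d p : homog_of_degree d p -> hcomp d p = p.
Proof.
move/homog_of_degreeE=> hp; apply/mpolyP=> k; rewrite mcoeff_mfilter.
by case: eqP => // ne; apply/esym/eqP; apply: contra_notT ne => /hp.
Qed.

Lemma hcomp_neq d e p : homog_of_degree e p -> e != d -> hcomp d p = 0.
Proof.
move/homog_of_degreeE=> hp ne; apply/mpolyP=> k; rewrite mcoeff_mfilter mcoeff0.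
case: eqP => // kd; apply/eqP; apply: contraNT ne => /hp <-.
exact/eqP.
Qed.

(** Additivity in [p] reduces this to a single term, where both sides are the whole product or both
    vanish. *)
Lemma hcompM d e p q :
  homog_of_degree e q -> hcomp d (p * q) = hcomp (d - e) p * q.
Proof.
move=> hq; elim/mpolyind: p => [|c k p _ _ IHp].
  have z d' : hcomp d' 0 = 0 by exact: (hcomp_id (homog0 d')).
  by rewrite mul0r !z mul0r.
rewrite mulrDl /hcomp !mfilterD -/(hcomp d) -/(hcomp (d - e)) IHp mulrDl.
congr (_ + _); rewrite -mul_mpolyC.
have hX : homog_of_degree (mdeg k)%:Z (c%:MP * 'X_[k] : S).
  rewrite mul_mpolyC => k'; move/msuppZ_le; exact: homogX.
have [E | NE] := eqVneq ((mdeg k)%:Z) (d - e).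
  rewrite -E in hX *; rewrite !hcomp_id //.
  by have := homogM hX hq; rewrite E subrK.
rewrite (hcomp_neq hX NE) mul0r (hcomp_neq (homogM hX hq)) //.
by apply: contraNneq NE => <-; rewrite addrK.
Qed.

Lemma homog_mcoeff0 d p : homog_of_degree d p -> p@_0 != 0 -> d = 0.
Proof. by move/homog_of_degreeE=> hp /hp <-; rewrite mdeg0. Qed.

(** Matrices act on row vectors from the right, so this describes a degree-preserving map from the
    free module with shifts [s] to the one with shifts [t]. *)
Definition homog_mx a b (s : 'I_a -> int) (t : 'I_b -> int) (M : 'M[S]_(a, b)) :=
  forall i j, homog_of_degree (s i - t j) (M i j).

Lemma homog_mxB a b s t (M N : 'M[S]_(a, b)) :
  homog_mx s t M -> homog_mx s t N -> homog_mx s t (M - N).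
Proof. by move=> hM hN i j; rewrite !mxE; apply/homogD/homogN. Qed.

Lemma homog_mxM a b c s t u (M : 'M[S]_(a, b)) (N : 'M[S]_(b, c)) :
  homog_mx s t M -> homog_mx t u N -> homog_mx s u (M *m N).
Proof.
move=> hM hN i j; rewrite mxE; apply: homog_sum => k.
have -> : s i - u j = s i - t k + (t k - u j) by rewrite addrA subrK.
exact: homogM.
Qed.

Lemma homog_mx1 a (s : 'I_a -> int) : homog_mx s s 1%:M.
Proof.
move=> i j; rewrite mxE; case: eqP => [-> | _]; last exact: homog0.
by rewrite subrr; exact: homog1.
Qed.

Lemma homog_mx_shift a b s t (d : int) (M : 'M[S]_(a, b)) :
  homog_mx s t M -> homog_mx (fun i => s i + d) (fun j => t j + d) M.
Proof. by move=> hM i j; rewrite /= opprD addrACA subrr addr0; exact: hM. Qed.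

(** Lift the rows of [M] through [B] one by one, then keep in each entry only the component of the
    required degree. Since [M] and [B] are homogeneous, the discarded components contribute nothing
    to the product. *)
Lemma homog_mx_lift a b c s t u (M : 'M[S]_(a, c)) (B : 'M[S]_(b, c)) :
    homog_mx s u M -> homog_mx t u B ->
    (forall v : 'rV_a, exists w, v *m M = w *m B) ->
  exists2 N : 'M_(a, b), homog_mx s t N & M = N *m B.
Proof.
move=> hM hB lift.
have [f fP] : exists f : 'I_a -> 'rV_b, forall i, row i M = f i *m B.
  apply: (@fin_all_exists 'I_a (fun=> 'rV_b) (fun i w => row i M = w *m B)) => i.
  have [w] := lift (delta_mx 0 i); rewrite -rowE; by exists w.
exists (\matrix_(i, k) hcomp (s i - t k) (f i 0 k)).
  by move=> i k; rewrite mxE; exact: hcomp_homog.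
apply/matrixP=> i j; rewrite mxE.
have /matrixP/(_ 0 j) := fP i; rewrite !mxE => E.
rewrite -(hcomp_id (hM i j)) E /hcomp mfilter_sum; apply: eq_bigr => k _.
rewrite mxE -/(hcomp _) (hcompM _ _ (hB k j)).
by congr (hcomp _ _ * _); rewrite opprB addrA subrK.
Qed.

End HomogeneousComponents.

(** * Comparison of graded resolutions *)

Section Resolutions.
Local Open Scope ring_scope.
Variables (K : fieldType) (m : nat).
Local Notation S := {mpoly K[m]}.
Implicit Types (F G : free_complex K m) (I J : S -> Prop).

(* The complex [F], augmented to a resolution of [S / I]: position [0] holds [S]
   and position [i.+1] holds [F_i]. *)
Definition xrank F i := if i is i'.+1 then grank F i' else 1.

Definition xshift F i : 'I_(xrank F i) -> int :=
  match i with 0 => fun=> 0 | i'.+1 => @gshift _ _ F i' end.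

Definition xdiff F i : 'M[S]_(xrank F i.+1, xrank F i) :=
  match i with 0 => gaug F | i'.+1 => gdiff F i' end.

Lemma xdiff_homog I F i :
  graded_free_resolution I F -> homog_mx (@xshift F i.+1) (@xshift F i) (xdiff F i).
Proof.
case=> hd ha _ _ _; case: i => [|i] a b; last exact: hd.
by rewrite (ord1 b) subr0; exact: ha.
Qed.

Arguments xdiff_homog {I F} i _.

Lemma xdiff_exact I F i (v : 'rV_(xrank F i.+1)) :
  graded_free_resolution I F ->
  v *m xdiff F i = 0 <-> exists w, v = w *m xdiff F i.+1.
Proof. by case=> _ _ _ e0 e; case: i v => [|i] v; [exact: e0 | exact: e]. Qed.

Lemma xdiff_aug I F p :
  graded_free_resolution I F ->
  I p <-> exists v : 'rV_(xrank F 1), p%:M = v *m xdiff F 0.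
Proof.
case=> _ _ aug _ _; rewrite aug; split=> -[v E]; exists v.
  by rewrite E -mx11_scalar.
by rewrite -E mxE eqxx.
Qed.

Lemma xdiff_xdiff I F i :
  graded_free_resolution I F -> xdiff F i.+1 *m xdiff F i = 0.
Proof.
move=> resF; apply/row_matrixP=> k; rewrite row_mul row0.
by apply/(xdiff_exact _ resF); exists (delta_mx 0 k); rewrite rowE.
Qed.

(** Multiplication by [u] maps S/I to S/J and is lifted along the augmented resolutions. It serves
    with [u = 1] to compare two resolutions of one ideal, and with a monomial [u] to form a mapping
    cone. *)
Lemma comparison_map I J F G (d : int) (u : S) :
    graded_free_resolution I F -> graded_free_resolution J G ->
    homog_of_degree d u -> (forall p, I p -> J (p * u)) ->
  exists phi : forall i, 'M[S]_(xrank F i, xrank G i),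
    phi 0 = u%:M /\
    forall i, homog_mx (fun k => @xshift F i k + d) (@xshift G i) (phi i) /\
              xdiff F i *m phi i = phi i.+1 *m xdiff G i.
Proof.
move=> resF resG hu IJ.
pose P i (t : 'M[S]_(xrank F i, xrank G i)) :=
  homog_mx (fun k => @xshift F i k + d) (@xshift G i) t /\
  forall v : 'rV_(xrank F i.+1), exists w, v *m (xdiff F i *m t) = w *m xdiff G i.
pose Q i (t : 'M[S]_(xrank F i, xrank G i)) (t' : 'M_(xrank F i.+1, xrank G i.+1)) :=
  xdiff F i *m t = t' *m xdiff G i.
have [||phi [phi0 phiP]] := @dependent_choice_nat _ P Q u%:M.
- split=> [i j | v].
    rewrite mxE !ord1 eqxx /xshift add0r subr0 mulr1n; exact: hu.
  have Ip : I ((v *m xdiff F 0) 0 0).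
    by apply/(xdiff_aug _ resF); exists v; rewrite [RHS]mx11_scalar.
  have /(xdiff_aug _ resG)[w E] := IJ _ Ip; exists w.
  by rewrite -E mulmxA mul_mx_scalar [in LHS](mx11_scalar (v *m _)) scale_scalar_mx mulrC.
- move=> i t [ht lift].
  have hM := homog_mxM (homog_mx_shift d (xdiff_homog i resF)) ht.
  have [t' ht' E] := homog_mx_lift hM (xdiff_homog i resG) lift.
  exists t'; split=> //; split=> // v; rewrite mulmxA; apply/(xdiff_exact _ resG).
  by rewrite -!mulmxA -E (mulmxA (xdiff F i.+1)) (xdiff_xdiff _ resF) mul0mx mulmx0.
by exists phi; split=> // i; have [[h _] E] := phiP i.
Qed.

(** The invariant on [h i] says exactly that [D i.+1 - xdiff F i *m h i] is killed by [xdiff F i];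
    by exactness it then factors through [xdiff F i.+1], which gives [h i.+1]. *)
Lemma homotopy_to_zero I F (D : forall i, 'M[S]_(xrank F i)) :
    graded_free_resolution I F -> D 0 = 0 ->
    (forall i, homog_mx (@xshift F i) (@xshift F i) (D i) /\
               xdiff F i *m D i = D i.+1 *m xdiff F i) ->
  exists h : forall i, 'M[S]_(xrank F i, xrank F i.+1),
    h 0 = 0 /\
    forall i, homog_mx (@xshift F i) (@xshift F i.+1) (h i) /\
              D i.+1 = h i.+1 *m xdiff F i.+1 + xdiff F i *m h i.
Proof.
move=> resF D0 hD.
pose P i (t : 'M[S]_(xrank F i, xrank F i.+1)) :=
  homog_mx (@xshift F i) (@xshift F i.+1) t /\
  xdiff F i *m (D i - t *m xdiff F i) = 0.
pose Q i (t : 'M[S]_(xrank F i, xrank F i.+1))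
    (t' : 'M_(xrank F i.+1, xrank F i.+2)) :=
  D i.+1 = t' *m xdiff F i.+1 + xdiff F i *m t.
have [||h [h0 hP]] := @dependent_choice_nat _ P Q 0.
- split=> [i j|]; first by rewrite mxE; exact: homog0.
  by rewrite D0 mul0mx subrr mulmx0.
- move=> i t [ht Et].
  have hM := homog_mxB (proj1 (hD i.+1)) (homog_mxM (xdiff_homog i resF) ht).
  have [v|t' ht' E] := homog_mx_lift hM (xdiff_homog i.+1 resF).
    apply/(xdiff_exact _ resF); rewrite -mulmxA mulmxBl -(proj2 (hD i)).
    by rewrite -mulmxA -mulmxBr Et mulmx0.
  exists t'; split; last by rewrite /Q -E subrK.
  split=> //; rewrite -E opprB addrC subrK mulmxA (xdiff_xdiff _ resF).
  by rewrite mul0mx.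
by exists h; split=> // i; have [[hh _] E] := hP i.
Qed.

Lemma sub_tensor_degreeP F i (d : int) (v : 'rV[K]_(grank F i)) :
  reflect (forall k, v 0 k != 0 -> @gshift _ _ F i k = d)
          (v <= tensor_degree F i d)%MS.
Proof.
apply: (iffP idP) => [/submxP[w ->] k | H].
  rewrite mul_mx_diag !mxE; by case: (eqVneq (gshift k) d) => //= _; rewrite mulr0 eqxx.
suff -> : v = v *m tensor_degree F i d by exact: submxMl.
apply/rowP=> k; rewrite mul_mx_diag !mxE.
by case: eqP => [_ | ne]; rewrite ?mulr1 // mulr0; apply/eqP; apply: contra_notT ne => /H.
Qed.

(** Only an entry of degree 0 can have a nonzero constant term, so reduction modulo the variables
    links basis vectors of equal degree only. *)
Lemma sub_tensor_degreeM F G i j (d : int) (N : 'M[S]_(grank F i, grank G j))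
    (v : 'rV_(grank F i)) :
    homog_mx (@gshift _ _ F i) (@gshift _ _ G j) N ->
    (v <= tensor_degree F i d)%MS ->
  (v *m map_mx (mcoeff 0%MM) N <= tensor_degree G j d)%MS.
Proof.
move=> hN /sub_tensor_degreeP hv; apply/sub_tensor_degreeP=> l.
apply: contraNeq => ne; rewrite mxE big1 // => k _; rewrite mxE.
have [-> | /hv Ek] := eqVneq (v 0 k) 0; first by rewrite mul0r.
apply/eqP; rewrite mulf_eq0; apply/orP; right; apply: contraNT ne.
by move/(homog_mcoeff0 (hN k l))/subr0_eq <-; rewrite Ek.
Qed.

(** With comparison maps [phi] and [psi], the endomorphism 1 - phi psi of [F] is homotopic to zero.
    A cycle of degree above [r + i] is killed by [phi], because [G] has no basis vector of that
    degree at position [i]; the homotopy then exhibits it as a boundary. *)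
Lemma tor_bound I F G (r : int) :
    graded_free_resolution I F -> graded_free_resolution I G ->
    (forall i k, @gshift _ _ G i k <= r + i%:Z) ->
  forall i j, tor_neq0 F i j -> j - i%:Z <= r.
Proof.
move=> resF resG bG i j; rewrite lerBlDr; apply: contraR; rewrite -ltNge => lt_j.
have hid p : I p -> I (p * 1) by rewrite mulr1.
have [phi [phi0 hphi]] := comparison_map resF resG (@homog1 K m) hid.
have [psi [psi0 hpsi]] := comparison_map resG resF (@homog1 K m) hid.
have eqs H k (s := @xshift H k) a : s a + 0 = s a by rewrite addr0.
have hphi' k : homog_mx (@xshift F k) (@xshift G k) (phi k).
  by move=> a b; have := (hphi k).1 a b; rewrite eqs.
have hpsi' k : homog_mx (@xshift G k) (@xshift F k) (psi k).
  by move=> a b; have := (hpsi k).1 a b; rewrite eqs.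
pose D k := 1%:M - phi k *m psi k.
have [||h [h0 hh]] := homotopy_to_zero (D := D) resF.
- by rewrite /D phi0 psi0 mulmx1 subrr.
- move=> k; split; first by apply/homog_mxB/homog_mxM; first exact: homog_mx1.
  rewrite mulmxBr mulmxBl mulmx1 mul1mx mulmxA (hphi k).2 -!mulmxA.
  by rewrite (hpsi k).2.
have Ei := (hh i).2; have h_i := (hh i.+1).1.
apply/row_subP=> k; move: (row k _)
  (row_sub k (tensor_cycles F i :&: tensor_degree F i j)%MS).
move=> v; rewrite sub_capmx => /andP[cyc deg].
have v_phi : v *m map_mx (mcoeff 0%MM) (phi i.+1) = 0.
  have /sub_tensor_degreeP dl := sub_tensor_degreeM (hphi' i.+1) deg.
  apply/rowP=> l; rewrite [RHS]mxE; apply/eqP; apply: contraTT lt_j => /dl <-.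
  by rewrite -leNgt; exact: bG.
(* At position 0 every vector counts as a cycle, so [cyc] says nothing there, and [h 0 = 0] is used
   instead. *)
have v_h : v *m map_mx (mcoeff 0%MM) (xdiff F i *m h i) = 0.
  case: (i) v cyc {deg v_phi} => [|i'] v cyc.
    by rewrite h0 mulmx0 map_mx0 mulmx0.
  by rewrite map_mxM mulmxA (sub_kermxP cyc) mul0mx.
have Ev : v = v *m map_mx (mcoeff 0%MM) (h i.+1) *m tensor_diff F i.
  have E1 : map_mx (mcoeff 0%MM) (D i.+1 + phi i.+1 *m psi i.+1) = 1%:M.
    by rewrite subrK map_mx1.
  rewrite -[LHS]mulmx1 -E1.
  rewrite Ei !map_mxD !mulmxDr v_h addr0 !map_mxM !mulmxA v_phi mul0mx addr0.
  by [].
have /submxP[w Ew] := sub_tensor_degreeM h_i deg.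
by rewrite Ev Ew -mulmxA submxMl.
Qed.

End Resolutions.

Arguments xdiff_homog {K m I F} i _.
Arguments xdiff_exact {K m I F i} v _.
Arguments xdiff_xdiff {K m I F} i _.

(** * Mapping cones and monomial ideals *)

Section MappingCone.
Local Open Scope ring_scope.
Variables (K : fieldType) (m : nat).
Local Notation S := {mpoly K[m]}.
Implicit Types (F G H : free_complex K m) (I J : S -> Prop).

(** The augmented indexing of [H] places S(-d) at position 0, where its basis vector maps to the new
    generator [u], and the module [H_i] at position [i.+1]. *)
Definition mapping_cone G H (phi : forall i, 'M[S]_(xrank H i, xrank G i))
    (u : S) (d : int) : free_complex K m :=
  @FreeComplex K m (fun i => grank G i + xrank H i)%N
    (fun i k => match split k with
                | inl a => @gshift _ _ G i a
                | inr b => @xshift _ _ H i b + d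
                end)
    (fun i => block_mx (gdiff G i) 0 (phi i.+1) (- xdiff H i))
    (col_mx (gaug G) u%:M).

(** For exactness, the [H] part of a cycle is first written as a boundary of some [w]; adding the
    image of [w] under [phi] turns the [G] part into a cycle, hence a boundary of some [w']. The
    pair (w', -w) is the preimage. *)
Lemma mapping_cone_resolution I J I' G H
    (phi : forall i, 'M[S]_(xrank H i, xrank G i)) (u : S) (d : int) :
    graded_free_resolution I G -> graded_free_resolution J H ->
    homog_of_degree d u ->
    (forall p, I (p * u) -> J p) ->
    (forall p, I' p <-> exists q c, I q /\ p = q + c * u) ->
    phi 0 = u%:M ->
    (forall i, homog_mx (fun k => @xshift _ _ H i k + d) (@xshift _ _ G i) (phi i) /\
               xdiff H i *m phi i = phi i.+1 *m xdiff G i) ->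
  graded_free_resolution I' (mapping_cone phi u d).
Proof.
move=> resG resH hu IJ I'E phi0 hphi.
have E0 : phi 1 *m gaug G = u *: gaug H.
  by have := (hphi 0).2; rewrite phi0 mul_mx_scalar /= => <-.
split=> /=.
- move=> i a b; rewrite !mxE; case: (split a) => a'; rewrite mxE.
    case: (split b) => b'; first exact: (xdiff_homog i.+1 resG a' b').
    by rewrite mxE; exact: homog0.
  case: (split b) => b'; first exact: ((hphi i.+1).1 a' b').
  rewrite mxE; apply: homogN; rewrite opprD addrACA subrr addr0.
  exact: (xdiff_homog i resH a' b').
- move=> a; rewrite mxE; case: (split a) => a'.
    by have := xdiff_homog 0 resG a' 0; rewrite subr0.
  by rewrite mxE ord1 eqxx /xshift add0r.
- move=> p; rewrite I'E; split=> [[q [c [Iq ->]]] | [v ->]].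
    have /(xdiff_aug _ resG)[w E] := Iq; exists (row_mx w c%:M).
    by rewrite mul_row_col -[w *m _]E -scalar_mxM mxE !mxE eqxx !mulr1n.
  rewrite -[v]hsubmxK mul_row_col.
  exists ((lsubmx v *m gaug G) 0 0), (rsubmx v 0 0); split.
    by apply/(xdiff_aug _ resG); exists (lsubmx v); rewrite -mx11_scalar.
  by rewrite mxE; congr (_ + _); rewrite mul_mx_scalar mxE mulrC.
- move=> v; split=> [|[w ->]].
    rewrite -[v]hsubmxK mul_row_col; move: (lsubmx v) (rsubmx v) => g h E.
    (* At position 0 the cycle condition reads g + h u = 0 after augmentation of g, so h u lies in I
       and h in J. *)
    have /(xdiff_aug _ resH)[w Ew] : J (h 0 0).
      apply: IJ; apply/(xdiff_aug _ resG); exists (- g).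
      rewrite mulNmx; apply/eqP; rewrite -addr_eq0 addrC; apply/eqP.
      rewrite -[RHS]E; congr (_ + _).
      by rewrite scalar_mxM -mx11_scalar.
    have /(xdiff_exact _ resG)[w' Ew'] : (g + w *m phi 1) *m xdiff G 0 = 0.
      rewrite mulmxDl -mulmxA [phi 1 *m _]E0 -scalemxAr -[w *m _]Ew -[RHS]E.
      by congr (_ + _); rewrite -mul_mx_scalar -mx11_scalar.
    exists (row_mx w' (- w)); rewrite mul_row_block -Ew' mulmx0 add0r.
    by rewrite mulNmx addrK mulNmx mulmxN opprK -[w *m _]Ew -mx11_scalar.
  rewrite -mulmxA mul_block_col mul0mx addr0.
  have -> : gdiff G 0 *m gaug G = 0 by exact: (xdiff_xdiff 0 resG).
  by rewrite E0 mulNmx mul_mx_scalar subrr col_mx0 mulmx0.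
- move=> i v; split=> [|[w ->]].
    rewrite -[v]hsubmxK mul_row_block; move: (lsubmx v) (rsubmx v) => g h.
    rewrite mulmx0 add0r -row_mx0 => /eq_row_mx[Eg].
    rewrite mulmxN => /eqP; rewrite oppr_eq0 => /eqP /(xdiff_exact _ resH)[w Ew].
    have /(xdiff_exact _ resG)[w' Ew'] : (g + w *m phi i.+2) *m xdiff G i.+1 = 0.
      by rewrite mulmxDl -mulmxA -(hphi i.+1).2 mulmxA -Ew.
    exists (row_mx w' (- w)); rewrite mul_row_block -Ew' mulmx0 add0r.
    by rewrite mulNmx addrK mulNmx mulmxN opprK -Ew.
  rewrite -mulmxA mulmx_block !mul0mx !mulmx0 !add0r !addr0.
  rewrite [gdiff G i.+1 *m _](xdiff_xdiff i.+1 resG).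
  have -> := esym (hphi i.+1).2.
  rewrite mulNmx subrr mulNmx mulmxN opprK (xdiff_xdiff i resH).
  by rewrite block_mx0 mulmx0.
Qed.

End MappingCone.

Section MonomialIdeals.
Local Open Scope ring_scope.
Variables (K : fieldType) (m : nat).
Local Notation S := {mpoly K[m]}.
Implicit Types (P : pred 'X_{1..m}) (u k l : 'X_{1..m}).

(** A monomial ideal when [P] is [up_closed]. Encoding it by a predicate on exponents turns the
    colon by a monomial and the addition of a monomial generator into the boolean operations [colon]
    and [adjoin]. *)
Definition mideal P (p : S) : Prop := {in msupp p, forall k, P k}.

Definition up_closed P := forall k l, P k -> P (k + l)%MM.

Definition colon P u : pred 'X_{1..m} := fun k => P (k + u)%MM.

Definition adjoin P u : pred 'X_{1..m} := fun k => P k || (u <= k)%MM.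

(* [reg (mideal P) <= r]. *)
Definition reg_le (r : nat) P := exists G : free_complex K m,
  graded_free_resolution (mideal P) G /\
  forall i a, @gshift _ _ G i a <= r%:Z + i%:Z.

Lemma midealX P k : mideal P 'X_[k] <-> P k.
Proof.
split=> [H | Pk l]; first by apply: H; rewrite msuppX inE.
by rewrite msuppX inE => /eqP->.
Qed.

Lemma reg_le_eq r P Q : P =1 Q -> reg_le r P -> reg_le r Q.
Proof.
move=> PQ [G [[h1 h2 aug h4 h5] bG]]; exists G; split=> //; split=> // p.
rewrite -aug; split=> H k /H; by rewrite PQ.
Qed.

(** The resolution of the colon ideal enters the cone shifted by [mdeg u] in degree and by one in
    position, which explains the bound [r.+1]. *)
Lemma reg_le_adjoin (r rho : nat) P u :
    up_closed P -> reg_le r P -> reg_le rho (colon P u) ->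
    (mdeg u <= r)%N -> (rho + mdeg u <= r.+1)%N ->
  reg_le r (adjoin P u).
Proof.
move=> upP [G [resG bG]] [H [resH bH]] le1 le2.
have colonP p : mideal P (p * 'X_[u]) <-> mideal (colon P u) p.
  split=> Ip k; last first.
    by rewrite (perm_mem (msuppMX _ _)) => /mapP[l /Ip + ->]; rewrite /colon addmC.
  move=> kp; apply: Ip; rewrite (perm_mem (msuppMX _ _)).
  by apply/mapP; exists k; rewrite // addmC.
have [phi [phi0 hphi]] :=
  comparison_map resH resG (@homogX K m u) (fun p => (colonP p).2).
exists (mapping_cone phi 'X_[u] (mdeg u)%:Z); split.
  apply: (mapping_cone_resolution resG resH) => //; first exact: homogX.
    by move=> p /colonP.
  move=> p; split=> [Ip | [q [c [Iq ->]]]].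
    (* The terms of [p] outside [P] are all divisible by the monomial of exponent [u]. *)
    exists (mfilter P p), (\sum_(k <- msupp p | ~~ P k) p@_k *: 'X_[k - u]).
    split=> [k|].
      by rewrite mcoeff_msupp mcoeff_mfilter; case: ifP => //; rewrite eqxx.
    rewrite [LHS]mpolyE (bigID P) /=; congr (_ + _).
    rewrite mulr_suml big_seq_cond [RHS]big_seq_cond; apply: eq_bigr => k.
    move=> /andP[/Ip/orP[-> //|uk] _].
    by rewrite -scalerAl -mpolyXD submK.
  move=> k /msuppD_le; rewrite mem_cat => /orP[/Iq Pk|]; first by rewrite /adjoin Pk.
  rewrite (perm_mem (msuppMX _ _)) => /mapP[l _ ->].
  by rewrite /adjoin addmC lem_addl orbT.
move=> i k /=; case: (split k) => [a | b]; first exact: bG.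
(* Position 0 contributes the generator itself, of degree [mdeg u]; position [i.+1] contributes the
   shifts of [H_i]. *)
case: i b {k} => [|i] b /=; first by rewrite add0r addr0 lez_nat.
by have /= := bH i b; lia.
Qed.

Lemma reg_le_pred0 r : reg_le r pred0.
Proof.
exists (@FreeComplex K m (fun=> 0%N) (fun _ _ => 0) (fun _ => 0) 0).
split=> [|i []//]; split=> //=; try by [move=> i []|case].
- move=> p; split=> [Ip | [v ->]].
    exists 0; rewrite mul0mx mxE; apply: msuppnil0; case E: (msupp p) => [//|k l].
    by have := Ip k; rewrite E mem_head => /(_ isT).
  by rewrite [v]thinmx0 mul0mx mxE => k; rewrite msupp0.
- by move=> v; split=> _; [exists 0; rewrite [v]thinmx0 [RHS]thinmx0 | rewrite mulmx0].
- by move=> i v; split=> _; [exists 0; rewrite [v]thinmx0 [RHS]thinmx0 | rewrite mulmx0].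
Qed.

End MonomialIdeals.

(** * Regularity of monomial ideals by adjoining generators *)

Section RegularityOfMonomialIdeals.
Local Open Scope ring_scope.
Variables (K : fieldType) (m : nat).
Local Notation S := {mpoly K[m]}.
Implicit Types (P : pred 'X_{1..m}) (u k l : 'X_{1..m}).

(** Were the class of the generator a boundary, its coordinates could be chosen without constant
    terms. Some monomial of the augmentation would then properly divide it, against minimality. *)
Lemma tor0_minimal_generator P (F : free_complex K m) u :
    up_closed P -> graded_free_resolution (mideal P) F -> P u ->
    (forall j, (U_(j) <= u)%MM -> ~~ P (u - U_(j))%MM) ->
  tor_neq0 F 0 (mdeg u)%:Z.
Proof.
move=> upP resF Pu minu; apply/negP=> sub.
have hX : homog_mx (fun=> (mdeg u)%:Z) (@xshift _ _ F 0) ('X_[u]%:M : 'M[S]_1).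
  by move=> i j; rewrite subr0 mxE !ord1 eqxx; exact: homogX.
have [c|N hN EN] := homog_mx_lift hX (xdiff_homog 0 resF).
  have /(xdiff_aug _ resF)[v Ev] := (midealX K P u).2 Pu.
  by exists (c *m v); rewrite -mulmxA -Ev.
have N0 : (map_mx (mcoeff 0%MM) N <= tensor_degree F 0 (mdeg u)%:Z)%MS.
  apply/sub_tensor_degreeP=> k; rewrite mxE.
  by move/(homog_mcoeff0 (hN 0 k))/subr0_eq.
have : (map_mx (mcoeff 0%MM) N
         <= tensor_cycles F 0 :&: tensor_degree F 0 (mdeg u)%:Z)%MS.
  by rewrite sub_capmx submx1.
move/submx_trans/(_ sub)/submxP=> [w Ew].
(* Subtracting a boundary leaves the image under [gaug] unchanged and removes the constant terms of
   [N]. *)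
pose W := map_mx (@mpolyC m K) (w *m tensor_degree F 1 (mdeg u)%:Z).
pose N' := N - W *m gdiff F 0.
have N'0 : map_mx (mcoeff 0%MM) N' = 0.
  rewrite map_mxB map_mxM Ew mulmxA /tensor_diff.
  suff -> : map_mx (mcoeff 0%MM) W = w *m tensor_degree F 1 (mdeg u)%:Z.
    by rewrite subrr.
  by apply/matrixP=> i j; rewrite !mxE mpolyCK.
have : 'X_[u] = \sum_k N' 0 k * gaug F k 0.
  have E : 'X_[u]%:M = N' *m gaug F.
    rewrite mulmxBl -mulmxA [gdiff F 0 *m _](xdiff_xdiff 0 resF) mulmx0 subr0.
    exact: EN.
  by have /matrixP/(_ 0 0) := E; rewrite !mxE eqxx.
move=> E; have : u \in msupp (\sum_k N' 0 k * gaug F k 0).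
  by rewrite -E msuppX inE.
move/msupp_sum_le; rewrite filter_predT => /flattenP[_ /mapP[k _ ->]].
case/msuppM_le/allpairsP=> -[k1 k2] /= [].
rewrite mcoeff_msupp => k1N k2g Eu.
have k1n0 : k1 != 0%MM.
  apply: contraNneq k1N => ->.
  by have /matrixP/(_ 0 k) := N'0; rewrite !mxE => ->.
have Pk2 : P k2.
  have aug : mideal P (gaug F k 0).
    apply/(xdiff_aug _ resF); exists (delta_mx 0 k).
    by apply/matrixP=> i j; rewrite -rowE !mxE !ord1 eqxx.
  exact: aug.
have [j k1j] : exists j, k1 j != 0%N.
  apply/existsP; rewrite -negb_forall; apply: contraNN k1n0 => /forallP k10.
  by apply/eqP/mnmP=> j; rewrite mnm0E; apply/eqP.
have jk1 : (U_(j) <= k1)%MM by rewrite lep1mP.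
have ju : (U_(j) <= u)%MM by rewrite Eu (lepm_trans jk1) ?lem_addr.
have /negP[] := minu j ju.
by rewrite Eu addmC -addmBA // upP.
Qed.

Lemma regularity_is_monomial (r : nat) P (I : S -> Prop) u :
    (forall p, I p <-> mideal P p) -> up_closed P -> reg_le K r P ->
    P u -> mdeg u = r -> (forall j, (U_(j) <= u)%MM -> ~~ P (u - U_(j))%MM) ->
  regularity_is I r%:Z.
Proof.
move=> IP upP [G [resG bG]] Pu ur minu.
have resE F : graded_free_resolution I F <-> graded_free_resolution (mideal P) F.
  by split=> -[h1 h2 aug h4 h5]; split=> // p; rewrite -aug IP.
split=> [|F /resE resF]; first by exists G; apply/resE.
split; last exact: tor_bound resF resG bG.
exists 0%N, r%:Z; rewrite subr0 -ur; split=> //.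
exact: tor0_minimal_generator upP resF Pu minu.
Qed.

Lemma reg_le_principal u : reg_le K (mdeg u) (lem u).
Proof.
apply: (@reg_le_eq _ _ _ (adjoin pred0 u)) => //.
by apply: (@reg_le_adjoin _ _ _ 0) => //; exact: reg_le_pred0.
Qed.

(** A new variable is regular modulo the earlier ones, so the colon ideal equals the ideal already
    built and the bound 1 + 1 <= 2 suffices. *)
Lemma reg_le_variables (V : seq 'I_m) :
  reg_le K 1 (fun k => has (fun j => k j != 0%N) V).
Proof.
elim: V => [|j V IHV]; first exact: reg_le_pred0.
set P := (fun k => has _ V) in IHV.
have upP : up_closed P.
  move=> k l /hasP[i iV ki]; apply/hasP; exists i => //.
  by rewrite mnmDE addn_eq0 negb_and ki.
have [jV | jNV] := boolP (j \in V).
  apply: reg_le_eq IHV => k /=; rewrite /P.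
  by case: eqP => //= /eqP kj; apply/hasP; exists j.
apply: (@reg_le_eq _ _ _ (adjoin P U_(j))).
  by move=> k; rewrite /adjoin orbC lep1mP.
apply: (reg_le_adjoin (rho := 1)) => //; rewrite ?mdeg1 //.
apply: reg_le_eq IHV => k; apply: eq_in_has => i iV.
rewrite mnmDE mnm1E; case: (eqVneq j i) => [ji | _]; last by rewrite addn0.
by rewrite ji iV in jNV.
Qed.

(** The last two hypotheses say that the colon ideal is generated by the variables in [V], hence has
    regularity at most 1. *)
Lemma reg_le_adjoin_linear (r : nat) P u (V : seq 'I_m) :
    up_closed P -> reg_le K r P -> (mdeg u <= r)%N ->
    (forall j, j \in V -> P (u + U_(j))%MM) ->
    (forall k, P (k + u)%MM -> exists2 j, j \in V & k j != 0%N) ->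
  reg_le K r (adjoin P u).
Proof.
move=> upP regP ur VP PV; apply: (reg_le_adjoin (rho := 1)) => //.
apply: reg_le_eq (reg_le_variables V) => k; apply/hasP/idP; last exact: PV.
case=> j jV kj; rewrite /colon -(@submK _ U_(j)%MM k) ?lep1mP //.
by rewrite -addmA addmC (addmC U_(j)%MM); apply/upP/VP.
Qed.

End RegularityOfMonomialIdeals.

(** * Generators of the powers of the cover ideal *)

Section SortedAdjunction.
Variables (K : fieldType) (m : nat).

(** Generators are adjoined along a list sorted by [key]. A generator already in the ideal changes
    nothing, so [step] may assume [~~ P (g w)]; ties in [key] come in an unspecified order. *)
Lemma reg_le_sorted (T : finType) (A : pred T) (g : T -> 'X_{1..m})
    (key : T -> nat) (r : nat) :
    (forall w L (P := fun k => has (fun w' => (g w' <= k)%MM) L),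
       A w -> {subset L <= A} -> ~~ P (g w) ->
       (forall w', w' \in L -> key w' <= key w) ->
       (forall w', A w' -> key w' < key w -> w' \in L) ->
       up_closed P -> reg_le K r P -> reg_le K r (adjoin P (g w))) ->
  reg_le K r (fun k => [exists w, A w && (g w <= k)%MM]).
Proof.
move=> step; pose le := relpre key leq.
have le_tr : transitive le by move=> ? ? ?; exact: leq_trans.
have le_tot : total le by move=> ? ?; exact: leq_total.
pose L := sort le (enum A).
have memL w : (w \in L) = A w by rewrite mem_sort mem_enum.
have sorted_L : sorted le L by exact: sort_sorted.
have up L1 : up_closed (fun k => has (fun w' => (g w' <= k)%MM) L1).
  move=> k l /hasP[w wL gk]; apply/hasP; exists w => //.
  by rewrite (lepm_trans gk) ?lem_addr.
suff : forall L1 L2, L = L1 ++ L2 ->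
    reg_le K r (fun k => has (fun w' => (g w' <= k)%MM) L1).
  move/(_ L [::] (esym (cats0 L))); apply: reg_le_eq => k.
  apply/hasP/existsP => [[w] | [w /andP[Aw gw]]]; last by exists w; rewrite ?memL.
  by rewrite memL => Aw gw; exists w; rewrite Aw.
elim/last_ind=> [|L1 w IHL] L2 E; first exact: reg_le_pred0.
rewrite cat_rcons in E; have reg1 := IHL _ E.
move: sorted_L; rewrite E sorted_pairwise // pairwise_cat /= => /and3P[].
move=> /allrelP le12 _ /andP[/allP lew _].
set P := (fun k => has _ L1) in reg1.
apply: (@reg_le_eq _ _ _ (adjoin P (g w))).
  by move=> k; rewrite /adjoin /P has_rcons orbC.
have [Pw | nPw] := boolP (P (g w)).
  apply: reg_le_eq reg1 => k; rewrite /adjoin orbC.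
  by case: (boolP (_ <= k)%MM) => //= gk; rewrite -(submK gk) addmC; exact: up.
apply: step => //.
- by rewrite -memL E mem_cat mem_head orbT.
- by move=> w' w'L; rewrite unfold_in -memL E mem_cat w'L.
- by move=> w' w'L; apply: le12; rewrite ?mem_head.
- move=> w'; rewrite -memL E mem_cat inE => /or3P[// | /eqP-> | /lew].
    by rewrite ltnn.
  by rewrite /le /= leqNgt => /negPf->.
Qed.

End SortedAdjunction.

Section CrownPowers.
Variable (n : nat).
Implicit Types (a b c : nat) (i j : 'I_n) (k l : 'X_{1..n + n}).

(* The exponent of X^a Y^b M_i^c, where X and Y are the products of all the x_j
   and of all the y_j and M_i = X Y / (x_i y_i). *)
Definition gen a b c i : 'X_{1..n + n} :=
  [multinom match split v with
            | inl j => a + (j != i) * c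
            | inr j => b + (j != i) * c
            end | v < n + n].

Lemma gen_lshift a b c i j : gen a b c i (lshift n j) = a + (j != i) * c.
Proof. by rewrite mnmE (unsplitK (inl j : 'I_n + 'I_n)). Qed.

Lemma gen_rshift a b c i j : gen a b c i (rshift n j) = b + (j != i) * c.
Proof. by rewrite mnmE (unsplitK (inr j : 'I_n + 'I_n)). Qed.

Lemma mnm_le_shiftP k l :
  reflect (forall j, k (lshift n j) <= l (lshift n j) /\ k (rshift n j) <= l (rshift n j))
          (k <= l)%MM.
Proof.
apply: (iffP mnm_lepP) => [H j | H v]; first by split; exact: H.
by have [j ->|j ->] := split_ordP v; case: (H j).
Qed.

Lemma gen_leP a b c i k :
  reflect (forall j, a + (j != i) * c <= k (lshift n j) /\
                     b + (j != i) * c <= k (rshift n j))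
          (gen a b c i <= k)%MM.
Proof.
by apply: (iffP (mnm_le_shiftP _ _)) => H j; move: (H j);
   rewrite gen_lshift gen_rshift.
Qed.

Lemma sum_neq i c : \sum_(j < n) (j != i) * c = n.-1 * c.
Proof.
rewrite (bigD1 i) //= eqxx add0n (eq_bigr (fun=> c)) => [|j ->]; last exact: mul1n.
by rewrite sum_nat_const (eq_card (B := predC1 i)) // cardC1 card_ord.
Qed.

Lemma mdeg_gen a b c i : mdeg (gen a b c i) = n * (a + b) + 2 * n.-1 * c.
Proof.
rewrite mdegE big_split_ord /=.
under eq_bigr do rewrite gen_lshift; under [X in _ + X]eq_bigr do rewrite gen_rshift.
rewrite !big_split /= !sum_neq !sum_nat_const card_ord; lia.
Qed.

(** Bounding the exponents by [s] keeps the existential finite, hence boolean. For [c = 0] the index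
    [i] is a dummy. *)
Definition crown_power s : pred 'X_{1..n + n} := fun k =>
  [exists w : 'I_s.+1 * 'I_s.+1 * 'I_s.+1 * 'I_n,
     (w.1.1.1 + w.1.1.2 + w.1.2 == s) && (gen w.1.1.1 w.1.1.2 w.1.2 w.2 <= k)%MM].

Lemma crown_powerP s k :
  reflect (exists a b c i, a + b + c = s /\ (gen a b c i <= k)%MM) (crown_power s k).
Proof.
apply: (iffP existsP) => [[[[[a b] c] i] /= /andP[/eqP E le]] | [a [b [c [i [E le]]]]]].
  by exists a, b, c, i.
have [ha hb hc] : [/\ a < s.+1, b < s.+1 & c < s.+1] by split; lia.
by exists (Ordinal ha, Ordinal hb, Ordinal hc, i); rewrite /= E eqxx.
Qed.

Lemma up_closed_crown_power s : up_closed (crown_power s).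
Proof.
move=> k l /crown_powerP[a [b [c [i [E le]]]]]; apply/crown_powerP.
by exists a, b, c, i; rewrite (lepm_trans le) ?lem_addr.
Qed.

(* M_i M_j is a multiple of X Y when i != j. *)
Lemma crown_powerD s k l :
  crown_power s k -> crown_power 1 l -> crown_power s.+1 (k + l)%MM.
Proof.
move=> /crown_powerP[a [b [c [i [E /gen_leP kP]]]]].
move=> /crown_powerP[a' [b' [c' [i' [E' /gen_leP lP]]]]]; apply/crown_powerP.
have [c0 | c_gt0] := posnP c.
  exists (a + a'), (b + b'), c', i'; split; first lia.
  by apply/gen_leP => j; rewrite !mnmDE; have := kP j; have := lP j; lia.
have [ii' | ne] := eqVneq i i'; last have [c'0 | c'_gt0] := posnP c'.
- exists (a + a'), (b + b'), (c + c'), i; split; first lia.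
  by apply/gen_leP => j; rewrite !mnmDE; have := kP j; have := lP j; rewrite ii'; lia.
- exists (a + a'), (b + b'), c, i; split; first lia.
  by apply/gen_leP => j; rewrite !mnmDE; have := kP j; have := lP j; lia.
(* Here [c' = 1] and [a' = b' = 0]: one factor M_i and the factor M_i' are traded for X Y. *)
exists a.+1, b.+1, c.-1, i; split; first lia.
apply/gen_leP => j; rewrite !mnmDE; have := kP j; have := lP j.
case: (eqVneq j i) => [-> | _]; first by rewrite ne; lia.
by case: (j != i'); lia.
Qed.

(** Neither x_i nor y_i divides M_i^s, so a generator dividing it has [a = b = 0] and index [i]: it
    is M_i^s itself, which does not divide a proper divisor. *)
Lemma crown_power_minimal s i v :
    0 < s -> (U_(v) <= gen 0 0 s i)%MM ->
  ~~ crown_power s (gen 0 0 s i - U_(v))%MM.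
Proof.
move=> s_gt0; rewrite lep1mP => vn0.
apply/negP=> /crown_powerP[a [b [c [i' [E le]]]]].
have le' := lepm_trans le (lem_subr _ _).
have := elimT (gen_leP _ _ _ _ _) le' i.
rewrite gen_lshift gen_rshift eqxx /= => -[h1 h2].
have [ii' a0 b0] : [/\ i = i', a = 0 & b = 0].
  by case: (eqVneq i i') h1 h2 => [-> | _] /= h1 h2; split=> //; lia.
have cs : c = s by lia.
by have /mnm_lepP/(_ v) := le; rewrite mnmBE mnm1E eqxx -ii' a0 b0 cs; lia.
Qed.

End CrownPowers.

(** * Regularity bounds for the powers *)

Section CrownRegularity.
Variables (K : fieldType) (n : nat).
Hypothesis n_ge3 : 2 < n.
Implicit Types (i j : 'I_n) (k : 'X_{1..n + n}).

Lemma mdeg_gen_le s a b c i : a + b + c = s -> mdeg (gen a b c i) <= s * (2 * n - 2).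
Proof. by move=> <-; rewrite mdeg_gen; nia. Qed.

Lemma reg_crown_power s : 1 < s -> reg_le K (s * (2 * n - 2)) (@crown_power n s).
Proof.
move=> s_gt1.
(* As [b <= s], this key orders the generators lexicographically by [c], then [b]. *)
apply: (@reg_le_sorted K _ ('I_s.+1 * 'I_s.+1 * 'I_s.+1 * 'I_n)%type
  (fun w => w.1.1.1 + w.1.1.2 + w.1.2 == s)
  (fun w => gen w.1.1.1 w.1.1.2 w.1.2 w.2) (fun w => w.1.2 * s.+1 + w.1.1.2)).
move=> [[[a b] c] i] L P /= /eqP Es LA nP lekey gekey upP regP.
have deg := mdeg_gen_le i Es.
have inL a' b' c' i' k : a' + b' + c' = s -> c' * s.+1 + b' < c * s.+1 + b ->
    (gen a' b' c' i' <= k)%MM -> P k.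
  move=> E' lt' le'; apply/hasP.
  have [ha hb hc] : [/\ a' < s.+1, b' < s.+1 & c' < s.+1] by split; lia.
  exists (Ordinal ha, Ordinal hb, Ordinal hc, i') => //=.
  by apply: gekey => //=; exact/eqP.
have ofL k : P k -> exists a' b' c' i', [/\ a' + b' + c' = s,
    c' * s.+1 + b' <= c * s.+1 + b, (gen a' b' c' i' <= k)%MM &
    ~~ (gen a' b' c' i' <= gen a b c i)%MM].
  case/hasP=> -[[[a' b'] c'] i'] w'L /= le'; exists a', b', c', i'.
  split=> //; first by have /eqP := LA _ w'L.
    exact: (lekey _ w'L).
  by apply: contraNN nP => le''; apply/hasP; exists (a', b', c', i').
have [c0 | c_gt0] := posnP c; last first.
  (* Multiplying by x_i (or y_i) allows one M_i to be replaced by X (or Y), which lowers the key. *)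
  apply: (reg_le_adjoin_linear (V := [:: lshift n i; rshift n i])) => //.
    move=> v; rewrite !inE => /orP[] /eqP->.
      apply: (inL a.+1 b c.-1 i); try nia.
      apply/gen_leP => j; rewrite !mnmDE gen_lshift gen_rshift !mnm1E !eq_shift.
      by rewrite (eq_sym i j); case: (j == i) => /=; lia.
    apply: (inL a b.+1 c.-1 i); try nia.
    apply/gen_leP => j; rewrite !mnmDE gen_lshift gen_rshift !mnm1E !eq_shift.
    by rewrite (eq_sym i j); case: (j == i) => /=; lia.
  move=> k /ofL[a' [b' [c' [i' [E' le1 /gen_leP/(_ i) le2 nle]]]]].
  move: le2; rewrite !mnmDE gen_lshift gen_rshift eqxx => -[lx ly].
  have [kx | kx] := eqVneq (k (lshift n i)) 0; last first.
    by exists (lshift n i); rewrite ?mem_head.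
  have [ky | ky] := eqVneq (k (rshift n i)) 0; last first.
    by exists (rshift n i); rewrite // !inE eqxx orbT.
  (* If neither x_i nor y_i divides k, comparing exponents at both gives [i' = i], as otherwise the
     total would exceed [s]. Then [a' <= a] and [b' <= b] give [c <= c'], and the key forces
     equality. *)
  case/negP: nle; have ii' : i = i'.
    by apply/eqP/negPn/negP => ne; rewrite ne in lx ly; lia.
  rewrite -ii' eqxx in lx ly *; have c'c : c' = c by nia.
  have [-> ->] : a' = a /\ b' = b by lia.
  by rewrite c'c lepm_refl.
rewrite c0 in Es inL ofL deg *.
have c'0 a' b' c' : a' + b' + c' = s -> c' * s.+1 + b' <= 0 * s.+1 + b -> c' = 0.
  by nia.
have genP a' b' i' k : reflect (forall j, a' <= k (lshift n j) /\ b' <= k (rshift n j))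
    (gen a' b' 0 i' <= k)%MM.
  by apply: (iffP (gen_leP _ _ _ _ _)) => H j; move: (H j); rewrite muln0 !addn0.
have [b0 | b_gt0] := posnP b.
  apply: (reg_le_adjoin (rho := 0)) => //; last by lia.
  apply: reg_le_eq (reg_le_pred0 K _ 0) => k; apply/esym/negbTE/negP.
  case/ofL=> [a' [b' [c' [i' [E' le1 _ /negP[]]]]]].
  have c'E := c'0 _ _ _ E' le1; rewrite c'E in E' le1 *.
  by apply/genP => j; rewrite gen_lshift gen_rshift; lia.
(* The colon ideal is (X), of regularity n. The inequality needed, n + n s <= s (2n - 2) + 1, is an
   equality for s = 2 and n = 3, and fails for s = 1. *)
apply: (reg_le_adjoin (rho := n)) => //; last by move: deg; rewrite mdeg_gen; nia.
have := reg_le_principal K (gen 1 0 0 i).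
rewrite mdeg_gen !addn0 !muln0 addn0 muln1; apply: reg_le_eq => k.
apply/genP/idP => [kP | /ofL[a' [b' [c' [i' [E' le1]]]]]].
  apply: (inL a.+1 b.-1 0 i); try lia.
  apply/genP => j; rewrite !mnmDE gen_lshift gen_rshift; have := kP j; lia.
have c'E := c'0 _ _ _ E' le1; rewrite c'E in E' le1 * => /genP le2 /genP nle j.
split=> //; have := le2 j; rewrite !mnmDE gen_lshift gen_rshift.
suff : a < a' by lia.
rewrite ltnNge; apply/negP=> aa'; case: nle => j'.
by rewrite gen_lshift gen_rshift; lia.
Qed.

(* [gen 0 0 1 i - gen 0 1 0 i] is the exponent of X / x_i: the subtraction
   truncates at y_i. *)
Lemma reg_partial_products :
  reg_le K n.-1 (fun k => [exists i, true && (gen 0 0 1 i - gen 0 1 0 i <= k)%MM]).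
Proof.
have genP i k : reflect (forall j, (j != i) <= k (lshift n j))
    (gen 0 0 1 i - gen 0 1 0 i <= k)%MM.
  apply: (iffP (mnm_le_shiftP _ _)) => H j; have := H j;
    by rewrite !mnmBE !gen_lshift !gen_rshift; case: (j == i) => /=; lia.
apply: (@reg_le_sorted K _ 'I_n predT (fun i => gen 0 0 1 i - gen 0 1 0 i)%MM (fun=> 0)).
move=> i L P _ _ /= nP _ _ upP regP.
have neq i' : i' \in L -> i' != i.
  by move=> i'L; apply: contraNneq nP => <-; apply/hasP; exists i'; rewrite ?lepm_refl.
have deg : mdeg (gen 0 0 1 i - gen 0 1 0 i) = n.-1.
  rewrite mdegE big_split_ord /=.
  under eq_bigr do rewrite mnmBE !gen_lshift muln0 !addn0 subn0 add0n.
  rewrite sum_neq muln1 big1 ?addn0 // => j _.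
  by rewrite mnmBE !gen_rshift; case: (j != i).
(* The first product has zero colon ideal. Afterwards x_i (X / x_i) = X is a multiple of any earlier
   X / x_i', so the colon ideal is (x_i). *)
case: L @P nP upP regP neq => [|i' L] P nP upP regP neq.
  by apply: (reg_le_adjoin (rho := 0)); rewrite ?deg //; exact: reg_le_pred0.
apply: (reg_le_adjoin_linear (V := [:: lshift n i])); rewrite ?deg //.
  move=> v; rewrite inE => /eqP->; apply/hasP; exists i'; rewrite ?mem_head //.
  apply/genP=> j; rewrite mnmDE mnmBE !gen_lshift mnm1E eq_shift (eq_sym i).
  by case: (j == i); case: (j == i').
move=> k /hasP[i'' /neq ne /genP/(_ i)]; rewrite mnmDE mnmBE !gen_lshift eqxx.
by rewrite eq_sym ne => ki; exists (lshift n i); rewrite ?mem_head //; lia.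
Qed.

(* Here X and Y must not be adjoined consecutively: (X) : Y = (X) has regularity
   n, one too many.  The order X, M_i, Y replaces this colon ideal by the one
   generated by the X / x_i. *)
Lemma reg_crown_power1 : reg_le K (2 * n - 2) (@crown_power n 1).
Proof.
(* Since a + b + c = 1, the keys of X, M_i and Y are 0, 1 and 2. *)
apply: (@reg_le_sorted K _ ('I_2 * 'I_2 * 'I_2 * 'I_n)%type
  (fun w => w.1.1.1 + w.1.1.2 + w.1.2 == 1)
  (fun w => gen w.1.1.1 w.1.1.2 w.1.2 w.2) (fun w => w.1.2 + 2 * w.1.1.2)).
move=> [[[a b] c] i] L P /= /eqP Es LA nP lekey gekey upP regP.
have deg : mdeg (gen a b c i) <= 2 * n - 2.
  by have := mdeg_gen_le i Es; rewrite mul1n.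
have inL a' b' c' i' k : a' + b' + c' = 1 -> c' + 2 * b' < c + 2 * b ->
    (gen a' b' c' i' <= k)%MM -> P k.
  move=> E' lt' le'; apply/hasP.
  have [ha hb hc] : [/\ a' < 2, b' < 2 & c' < 2] by split; lia.
  exists (Ordinal ha, Ordinal hb, Ordinal hc, i') => //=.
  by apply: gekey => //=; exact/eqP.
have ofL k : P k -> exists a' b' c' i', [/\ a' + b' + c' = 1,
    c' + 2 * b' <= c + 2 * b, (gen a' b' c' i' <= k)%MM &
    ~~ (gen a' b' c' i' <= gen a b c i)%MM].
  case/hasP=> -[[[a' b'] c'] i'] w'L /= le'; exists a', b', c', i'.
  split=> //; first by have /eqP := LA _ w'L.
    exact: (lekey _ w'L).
  by apply: contraNN nP => le''; apply/hasP; exists (a', b', c', i').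
have [c0 | c_gt0] := posnP c; last first.
  have [a0 b0 c1] : [/\ a = 0 :> nat, b = 0 :> nat & c = 1 :> nat] by split; lia.
  rewrite a0 b0 c1 in inL ofL deg *.
  (* X : M_i is (x_i), and an earlier M_i' only contributes x_i y_i. *)
  apply: (reg_le_adjoin_linear (V := [:: lshift n i])) => //.
    move=> v; rewrite inE => /eqP->; apply: (inL 1 0 0 i) => //.
    apply/gen_leP => j; rewrite !mnmDE gen_lshift gen_rshift !mnm1E !eq_shift.
    by rewrite (eq_sym i j); case: (j == i).
  move=> k /ofL[a' [b' [c' [i' [E' le1 /gen_leP/(_ i) [+ _] nle]]]]].
  rewrite mnmDE gen_lshift eqxx /= => lx; exists (lshift n i); first by rewrite mem_head.
  apply: contraNneq nle => kx; rewrite kx in lx.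
  have [-> -> ->] : [/\ a' = 0, b' = 0 & c' = 1] by split; lia.
  suff -> : i' = i by exact: lepm_refl.
  by apply/eqP/negPn/negP => ne; rewrite eq_sym ne in lx; lia.
rewrite c0 in Es inL ofL deg *.
have [b0 | b_gt0] := posnP b.
  have a1 : a = 1 :> nat by lia.
  rewrite a1 b0 in inL ofL deg *.
  apply: (reg_le_adjoin (rho := 0)) => //; last by lia.
  apply: reg_le_eq (reg_le_pred0 K _ 0) => k; apply/esym/negbTE/negP.
  case/ofL=> [a' [b' [c' [i' [E' le1 _ /negP[]]]]]].
  have [-> -> ->] : [/\ a' = 1, b' = 0 & c' = 0] by split; lia.
  by apply/gen_leP => j; rewrite gen_lshift gen_rshift; lia.
have [a0 b1] : a = 0 :> nat /\ b = 1 :> nat by lia.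
rewrite a0 b1 in inL ofL deg *.
(* M_i : Y is generated by X / x_i, and these products already divide X. The bound (n - 1) + n <=
   (2n - 2) + 1 is sharp. *)
apply: (reg_le_adjoin (rho := n.-1)) => //; last by rewrite mdeg_gen; lia.
apply: reg_le_eq reg_partial_products => k.
apply/existsP/idP => [[i' /mnm_le_shiftP le'] | ].
  apply: (inL 0 0 1 i') => //; apply/gen_leP=> j; have [+ _] := le' j.
  rewrite mnmBE !mnmDE !gen_lshift !gen_rshift.
  by case: (j == i') => /=; lia.
case/ofL=> [a' [b' [c' [i' [E' le1 /gen_leP le2 nle]]]]]; exists i'.
apply/mnm_le_shiftP => j; have [] := le2 j.
rewrite !mnmBE !mnmDE !gen_lshift !gen_rshift.
suff b'0 : b' = 0 by case: (j == i') => /=; lia.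
have [//|b'_gt0] := posnP b'; case/negP: nle.
have [-> -> ->] : [/\ a' = 0, b' = 1 & c' = 0] by split; lia.
by apply/gen_leP => j'; rewrite gen_lshift gen_rshift; lia.
Qed.

End CrownRegularity.

(** * Minimal vertex covers and the cover ideal *)

Section CrownCovers.
Variable (n : nat).
Hypothesis n_ge3 : 2 < n.
Implicit Types (i j : 'I_n) (C : {set 'I_(n + n)}).

Definition cover_monomial C : 'X_{1..n + n} := [multinom (v \in C : nat) | v < n + n].

Definition left_side : {set 'I_(n + n)} := [set lshift n j | j : 'I_n].
Definition right_side : {set 'I_(n + n)} := [set rshift n j | j : 'I_n].
Definition co_pair i : {set 'I_(n + n)} := ~: [set lshift n i; rshift n i].

Lemma mem_left_side j :
  (lshift n j \in left_side) * ((rshift n j \in left_side) = false).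
Proof.
split; first exact: imset_f.
by apply/imsetP=> -[i _ /eqP]; rewrite eq_shift.
Qed.

Lemma mem_right_side j :
  (rshift n j \in right_side) * ((lshift n j \in right_side) = false).
Proof.
split; first exact: imset_f.
by apply/imsetP=> -[i _ /eqP]; rewrite eq_shift.
Qed.

Lemma mem_co_pair i j : ((lshift n j \in co_pair i) = (j != i)) *
                        ((rshift n j \in co_pair i) = (j != i)).
Proof. by rewrite !inE !eq_shift orbF. Qed.

Lemma crown_coverP C :
  reflect (forall i j, i != j -> (lshift n i \in C) || (rshift n j \in C))
          (vertex_cover (crown n) C).
Proof.
have splitl i : split (lshift n i) = inl i by exact: (unsplitK (inl i)).
have splitr i : split (rshift n i) = inr i by exact: (unsplitK (inr i)).
apply: (iffP forallP) => [cov i j ij | cov u].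
  have /forallP/(_ (rshift n j)) := cov (lshift n i).
  by rewrite /crown splitl splitr ij.
apply/forallP=> v; rewrite /crown.
have [i ->|i ->] := split_ordP u; have [j ->|j ->] := split_ordP v;
  rewrite ?splitl ?splitr //=; apply/implyP=> ij; first exact: cov.
by rewrite orbC; apply: cov; rewrite eq_sym.
Qed.

Lemma other i : exists j, j != i.
Proof.
have [j] : exists j, j \in [set~ i].
  by apply/set0Pn; rewrite -card_gt0 cardsC1 card_ord; lia.
by rewrite !inE; exists j.
Qed.

Lemma set_shiftP C (D : {set 'I_(n + n)}) :
  reflect (forall j, (lshift n j \in C -> lshift n j \in D) /\
                     (rshift n j \in C -> rshift n j \in D)) (C \subset D).
Proof.
apply: (iffP subsetP) => [H j | H v]; first by split; exact: H.
by have [j ->|j ->] := split_ordP v; case: (H j).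
Qed.

Lemma left_side_minimal : minimal_vertex_cover (crown n) left_side.
Proof.
apply/minsetP; split=> [|B /crown_coverP cov sub].
  by apply/crown_coverP => i j _; rewrite mem_left_side.
apply/eqP; rewrite eqEsubset sub; apply/set_shiftP => i.
rewrite !mem_left_side; split=> // _; have [j ji] := other i.
rewrite eq_sym in ji; have /orP[//|jB] := cov i j ji.
by have := subsetP sub _ jB; rewrite mem_left_side.
Qed.

Lemma right_side_minimal : minimal_vertex_cover (crown n) right_side.
Proof.
apply/minsetP; split=> [|B /crown_coverP cov sub].
  by apply/crown_coverP => i j _; rewrite !mem_right_side.
apply/eqP; rewrite eqEsubset sub; apply/set_shiftP => i.
rewrite !mem_right_side; split=> // _; have [j ji] := other i.
have /orP[jB|//] := cov j i ji.
by have := subsetP sub _ jB; rewrite mem_right_side.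
Qed.

(** Dropping x_j uncovers the edge {x_j, y_i}, and dropping y_j the edge {x_i, y_j}. *)
Lemma co_pair_minimal i : minimal_vertex_cover (crown n) (co_pair i).
Proof.
apply/minsetP; split=> [|B /crown_coverP cov sub].
  apply/crown_coverP => j j' jj'; rewrite !mem_co_pair -negb_and.
  by apply: contraNN jj' => /andP[/eqP-> /eqP->].
apply/eqP; rewrite eqEsubset sub; apply/set_shiftP => j.
rewrite !mem_co_pair; split=> ji.
  have /orP[//|iB] := cov j i ji.
  by have := subsetP sub _ iB; rewrite mem_co_pair eqxx.
have /orP[iB|//] : (lshift n i \in B) || (rshift n j \in B).
  by apply: cov; rewrite eq_sym.
by have := subsetP sub _ iB; rewrite mem_co_pair eqxx.
Qed.

(** If x_i is missing, every y_j with j != i is present. Either y_i is present too, or its absence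
    forces every x_j with j != i. *)
Lemma crown_cover_sub C : vertex_cover (crown n) C ->
  [\/ left_side \subset C, right_side \subset C | exists i, co_pair i \subset C].
Proof.
move/crown_coverP=> cov.
have [/forallP HL | /forallPn[i iN]] := boolP [forall i, lshift n i \in C].
  by apply: Or31; apply/subsetP=> _ /imsetP[j _ ->].
have rC j : j != i -> rshift n j \in C.
  by rewrite eq_sym => /cov; rewrite (negPf iN).
have [iC | iNr] := boolP (rshift n i \in C).
  apply: Or32; apply/subsetP=> _ /imsetP[j _ ->].
  by have [-> //| /rC] := eqVneq j i.
apply: Or33; exists i; apply/set_shiftP=> j; rewrite !mem_co_pair.
split=> [ji|]; last exact: rC.
by have := cov j i ji; rewrite (negPf iNr) orbF.
Qed.

Lemma minimal_crown_coverP C : minimal_vertex_cover (crown n) C ->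
  [\/ C = left_side, C = right_side | exists i, C = co_pair i].
Proof.
case/minsetP=> cov minC.
have E D : minimal_vertex_cover (crown n) D -> D \subset C -> C = D.
  by move=> /minsetp covD sub; rewrite (minC D).
case: (crown_cover_sub cov) => [sub | sub | [i sub]].
- by apply: Or31; apply: E sub; exact: left_side_minimal.
- by apply: Or32; apply: E sub; exact: right_side_minimal.
- by apply: Or33; exists i; apply: E sub; exact: co_pair_minimal.
Qed.

Lemma crown_cover_degree : cover_degree (crown n) = 2 * n - 2.
Proof.
have card_pair i : #|co_pair i| = 2 * n - 2.
  by rewrite cardsCs setCK cards2 eq_shift card_ord /=; lia.
apply/eqP; rewrite eqn_leq; apply/andP; split.
  apply/bigmax_leqP => C /minimal_crown_coverP[-> | -> | [i ->]].
  - by rewrite card_imset ?card_ord; [lia | exact: lshift_inj].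
  - by rewrite card_imset ?card_ord; [lia | exact: rshift_inj].
  - by rewrite card_pair.
have i : 'I_n by apply: (@Ordinal n 0); lia.
by rewrite -(card_pair i); apply: leq_bigmax_cond; exact: co_pair_minimal.
Qed.

Lemma cover_monomial_left i : cover_monomial left_side = gen 1 0 0 i.
Proof.
apply/mnmP=> v; rewrite mnmE; have [j ->|j ->] := split_ordP v.
  by rewrite gen_lshift mem_left_side muln0.
by rewrite gen_rshift mem_left_side muln0.
Qed.

Lemma cover_monomial_right i : cover_monomial right_side = gen 0 1 0 i.
Proof.
apply/mnmP=> v; rewrite mnmE; have [j ->|j ->] := split_ordP v.
  by rewrite gen_lshift mem_right_side muln0.
by rewrite gen_rshift mem_right_side muln0.
Qed.

Lemma cover_monomial_co_pair i : cover_monomial (co_pair i) = gen 0 0 1 i.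
Proof.
apply/mnmP=> v; rewrite mnmE; have [j ->|j ->] := split_ordP v.
  by rewrite gen_lshift mem_co_pair muln1.
by rewrite gen_rshift mem_co_pair muln1.
Qed.

Lemma crown_power_cover C :
  minimal_vertex_cover (crown n) C -> crown_power 1 (cover_monomial C).
Proof.
have i : 'I_n by apply: (@Ordinal n 0); lia.
case/minimal_crown_coverP => [-> | -> | [j ->]]; apply/crown_powerP.
- by exists 1, 0, 0, i; rewrite (cover_monomial_left i) lepm_refl.
- by exists 0, 1, 0, i; rewrite (cover_monomial_right i) lepm_refl.
- by exists 0, 0, 1, j; rewrite cover_monomial_co_pair lepm_refl.
Qed.

End CrownCovers.

(** * Powers of the cover ideal as monomial ideals *)

Section IdealPowers.
Local Open Scope ring_scope.
Variable (R : comNzRingType).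
Implicit Types (A I : R -> Prop).

Lemma ideal_gen_sum (T : eqType) A (L : seq T) (c g : T -> R) :
  (forall x, x \in L -> A (g x)) -> ideal_gen A (\sum_(x <- L) c x * g x).
Proof.
move=> gA; exists (size L), (fun t => c (tnth (in_tuple L) t)),
  (fun t => g (tnth (in_tuple L) t)); split; last by rewrite big_tnth.
by move=> t; apply: gA; exact: mem_tnth.
Qed.

Lemma ideal_gen_mem A p : A p -> ideal_gen A p.
Proof.
move=> Ap; have := @ideal_gen_sum unit A [:: tt] (fun=> 1) (fun=> p).
by rewrite big_seq1 mul1r; apply.
Qed.

(** Convertible to the generating set inside [ideal_pow]. *)
Definition product_of I s p := exists g : 'I_s -> R,
  (forall t, I (g t)) /\ p = \prod_(t < s) g t.

Lemma product_ofM I s t p q :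
  product_of I s p -> product_of I t q -> product_of I (s + t) (p * q).
Proof.
case=> [f [fI ->]] [g [gI ->]].
exists (fun v => match split v with inl i => f i | inr j => g j end).
split=> [v|]; first by case: (split v).
rewrite big_split_ord; congr (_ * _); apply: eq_bigr => i _.
  by rewrite (unsplitK (inl i)).
by rewrite (unsplitK (inr i)).
Qed.

Lemma product_ofX I s p : I p -> product_of I s (p ^+ s).
Proof. by move=> Ip; exists (fun=> p); rewrite prodr_const card_ord. Qed.

End IdealPowers.

Section CrownIdeal.
Local Open Scope ring_scope.
Variables (K : fieldType) (n : nat).
Hypothesis n_ge3 : (2 < n)%N.
Local Notation S := {mpoly K[n + n]}.
Local Notation J := (@cover_ideal (n + n) K (crown n)).

Lemma mideal_gen (m : nat) (P : pred 'X_{1..m}) (A : {mpoly K[m]} -> Prop) p :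
  up_closed P -> (forall q, A q -> mideal P q) -> ideal_gen A p -> mideal P p.
Proof.
move=> upP AP [k [c [g [gA ->]]]] l.
move/msupp_sum_le; rewrite filter_predT => /flattenP[_ /mapP[i _ ->]].
case/msuppM_le/allpairsP=> -[k1 k2] /= [_ k2g ->].
by rewrite addmC; apply: upP; exact: AP (gA i) _ k2g.
Qed.

Lemma cover_monomialE (C : {set 'I_(n + n)}) :
  \prod_(u in C) 'X_u = 'X_[cover_monomial C] :> S.
Proof.
rewrite mprodXE; congr mpolyX; apply/mnmP=> v; rewrite mnm_sumE mnmE.
have [vC | vNC] := boolP (v \in C).
  rewrite (bigD1 v) //= mnm1E eqxx big1 // => u /andP[_ /negPf].
  by rewrite mnm1E => ->.
rewrite big1 // => u uC; rewrite mnm1E.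
by case: eqP uC vNC => // -> ->.
Qed.

Lemma cover_ideal_gen (C : {set 'I_(n + n)}) :
  minimal_vertex_cover (crown n) C -> J 'X_[cover_monomial C].
Proof. by move=> minC; apply: ideal_gen_mem; exists C; rewrite ?cover_monomialE. Qed.

Lemma cover_ideal_sub p : J p -> mideal (@crown_power n 1) p.
Proof.
apply: mideal_gen => [|_ [C minC ->]]; first exact: up_closed_crown_power.
by rewrite cover_monomialE midealX; exact: crown_power_cover.
Qed.

Lemma product_of_gen a b c i : product_of J (a + b + c) 'X_[gen a b c i].
Proof.
have -> : gen a b c i = (gen 1 0 0 i *+ a + gen 0 1 0 i *+ b + gen 0 0 1 i *+ c)%MM.
  apply/mnmP=> v; rewrite !mnmDE !mulmnE; have [j ->|j ->] := split_ordP v.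
    by rewrite !gen_lshift; case: (j == i) => /=; lia.
  by rewrite !gen_rshift; case: (j == i) => /=; lia.
rewrite !mpolyXD -!mpolyXn; apply: product_ofM; first apply: product_ofM.
- apply: product_ofX; rewrite -cover_monomial_left.
  by apply: cover_ideal_gen; exact: left_side_minimal.
- apply: product_ofX; rewrite -cover_monomial_right.
  by apply: cover_ideal_gen; exact: right_side_minimal.
- apply: product_ofX; rewrite -cover_monomial_co_pair.
  by apply: cover_ideal_gen; exact: co_pair_minimal.
Qed.

(** One inclusion multiplies generators by induction with [crown_powerD]; the other divides each
    monomial of [p] by a chosen generator. *)
Lemma crown_ideal_pow s p : ideal_pow J s p <-> mideal (@crown_power n s) p.
Proof.
split.
  apply: mideal_gen; first exact: up_closed_crown_power.
  move=> _ [g [gJ ->]]; elim: s g gJ => [|s IHs] g gJ.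
    rewrite big_ord0 -mpolyX0 midealX; apply/crown_powerP.
    have i : 'I_n by apply: (@Ordinal n 0); lia.
    by exists 0%N, 0%N, 0%N, i; split=> //; apply/gen_leP => j; rewrite !mnm0E muln0.
  rewrite big_ord_recr => l /msuppM_le/allpairsP[[k1 k2] /= [k1P k2P ->]].
  apply: crown_powerD; last exact: cover_ideal_sub (gJ _) _ k2P.
  exact: IHs k1P.
move=> Pp.
(* The default exponent 0 is never reached on the support of [p]. *)
pose f k := if [pick w : 'I_s.+1 * 'I_s.+1 * 'I_s.+1 * 'I_n |
    (w.1.1.1 + w.1.1.2 + w.1.2 == s)%N && (gen w.1.1.1 w.1.1.2 w.1.2 w.2 <= k)%MM]
  is Some w then gen w.1.1.1 w.1.1.2 w.1.2 w.2 else 0%MM.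
have fP k : k \in msupp p -> product_of J s 'X_[f k] /\ (f k <= k)%MM.
  move/Pp/existsP=> exw; rewrite /f.
  case: pickP => [w /andP[/eqP E le] | no]; last by case: exw => w; rewrite no.
  by split=> //; have := product_of_gen w.1.1.1 w.1.1.2 w.1.2 w.2; rewrite E.
have -> : p = \sum_(k <- msupp p) (p@_k *: 'X_[k - f k]) * 'X_[f k].
  rewrite [LHS]mpolyE big_seq [RHS]big_seq; apply: eq_bigr => k /fP[_ le].
  by rewrite -scalerAl -mpolyXD submK.
by apply: ideal_gen_sum => k /fP[].
Qed.

End CrownIdeal.

Theorem theorem3p4 (K : fieldType) (n : nat) (hn : 3 <= n)
    (s : nat) (hs : 1 <= s) :
  regularity_is (ideal_pow (cover_ideal K (crown n)) s)
    (Posz (s * cover_degree (crown n))).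
Proof.
have i : 'I_n by apply: (@Ordinal n 0); lia.
rewrite crown_cover_degree //.
apply: (regularity_is_monomial (P := @crown_power n s) (u := gen 0 0 s i)).
- exact: crown_ideal_pow.
- exact: up_closed_crown_power.
- have [s_gt1 | s_le1] := ltnP 1 s; first exact: reg_crown_power.
  have s1 : s = 1 by lia.
  by rewrite s1 mul1n; exact: reg_crown_power1.
- by apply/crown_powerP; exists 0, 0, s, i; rewrite lepm_refl.
- by rewrite mdeg_gen; nia.
- by move=> v; exact: crown_power_minimal.
Qed.
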